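(* Let $p$ be a prime, $m$ a positive integer, $L=\mathbb F_{p^m}\subset F=\mathbb F_{p^{2m}}$, and $\sigma=p^s$ with $1\le s<m$. Let $l,n,N,R\in L^*$ and $\mu\in F^*$. Then the following are presemifields of order $p^{2m}$: (a) $A(p,m,s,l,\mu)$, provided $-l\notin L^{\sigma-1}$ and $\overline{\mu}/\mu$ is not in the subgroup of index $\gcd(p^m+1,\sigma+1)$ of the group $(F^* )^{p^m-1}=\{x^{p^m-1}: x\in F^*\}$. (b) $B(p,m,s,l,n,N)$ with $p$ odd, provided $-l\notin L^{\sigma-1}$ and the polynomial $t^{\sigma+1}+(1-1/N)t+(1/n-1)/N$ has no root in $L$. (c) $C(p,m,s,l,R)$ with $p$ odd, provided $-l\notin L^{\sigma-1}$ and $R\notin L^{\sigma+1}$.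
   Context: A finite presemifield $(F,+,* )$ is a finite abelian group $(F,+)$ with a multiplication $*$ satisfying both distributive laws and such that $x*y=0$ implies $x=0$ or $y=0$ (associativity and an identity are not required). For an integer $k\ge 0$, $L^{k}$ denotes $\{x^k : x\in L\}$. Let $x\mapsto\overline{x}=x^{p^m}$ be the involutory automorphism of $F$ over $L$ and $T\colon F\to L$, $T(x)=x+\overline{x}$, the trace. Fix $\omega\in F^*$ with $T(\omega)=0$ (with $\omega=1$ if $p=2$) and fix $z\in F\setminus L$ (for $p$ odd one may take $z=\omega$; different choices of $z$ give isotopic algebras). $A(p,m,s,l,\mu)$ is $F$ with its addition and the multiplication $$x*y=T(\omega xy)+T\big(\omega\mu(\overline{x}\,y^{\sigma}+l\,\overline{x}^{\sigma}y)\big)z .$$ $B(p,m,s,l,n,N)$ is the additive group $L^2$ with multiplication $(a,b)*(c,d)=(h(a,b,c,d),\,ad+bc)$, where $$h(a,b,c,d)=ac^{\sigma}-nNbd^{\sigma}+l(a^{\sigma}c-nNb^{\sigma}d)+n\{Nad^{\sigma}-bc^{\sigma}+l(a^{\sigma}d-Nb^{\sigma}c)\}.$$ $C(p,m,s,l,R)$ is the additive group $L^2$ with multiplication $$(a,b)*(c,d)=\big(ac^{\sigma}+Rbd^{\sigma}+l(a^{\sigma}c+Rb^{\sigma}d),\ ad+bc\big).$$ *)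

(* Defs.v *)
From HB Require Import structures.
From mathcomp Require Import all_boot all_order all_algebra all_fingroup.
Set Implicit Arguments.
Unset Strict Implicit.
Unset Printing Implicit Defensive.
Import GRing.Theory.
Local Open Scope ring_scope.

(* The library puts no finZmodType structure on products; this joins the
   existing finite and componentwise additive structures. *)
HB.instance Definition _ (U V : finZmodType) := GRing.Zmodule.on (U * V)%type.

Definition presemifield (V : finZmodType) (mul : V -> V -> V) : Prop :=
  [/\ left_distributive mul +%R,
      right_distributive mul +%R &
      forall x y : V, mul x y = 0 -> x = 0 \/ y = 0].

Definition presemifield_of_order (V : finZmodType) (mul : V -> V -> V)
  (q : nat) : Prop := presemifield mul /\ #|V| = q.

Definition powers (K : finFieldType) (k : nat) : {set K} :=
  [set x ^+ k | x : K].

Definition unit_powers (K : finFieldType) (k : nat) : {set {unit K}} :=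
  [set (u ^+ k)%g | u : {unit K}].

Definition bar (F : finFieldType) (p m : nat) (x : F) : F := x ^+ (p ^ m).

(* The trace from F to its subfield of order p ^ m, seen as valued in F. *)
Definition trace (F : finFieldType) (p m : nat) (x : F) : F := x + bar p m x.

(* The parameter l is the image in F of an element of L. *)
Definition A_mul (F : finFieldType) (p m s : nat) (omega z l mu : F)
    (x y : F) : F :=
  let T := trace p m in
  let sigma := (p ^ s)%N in
  T (omega * x * y)
  + T (omega * mu * (bar p m x * y ^+ sigma + l * bar p m x ^+ sigma * y)) * z.

Definition B_mul (L : finFieldType) (p s : nat) (l n N : L)
    (u v : L * L) : L * L :=
  let sigma := (p ^ s)%N in
  let: (a, b) := u in
  let: (c, d) := v in
  (a * c ^+ sigma - n * N * b * d ^+ sigma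
   + l * (a ^+ sigma * c - n * N * b ^+ sigma * d)
   + n * (N * a * d ^+ sigma - b * c ^+ sigma
          + l * (a ^+ sigma * d - N * b ^+ sigma * c)),
   a * d + b * c).

Definition B_poly (L : finFieldType) (p s : nat) (n N : L) : {poly L} :=
  'X^(p ^ s + 1) + (1 - 1 / N) *: 'X + ((1 / n - 1) / N)%:P.

Definition C_mul (L : finFieldType) (p s : nat) (l R : L)
    (u v : L * L) : L * L :=
  let sigma := (p ^ s)%N in
  let: (a, b) := u in
  let: (c, d) := v in
  (a * c ^+ sigma + R * b * d ^+ sigma
   + l * (a ^+ sigma * c + R * b ^+ sigma * d),
   a * d + b * c).

(* Main.v *)
Require Import Defs.
From HB Require Import structures.
From mathcomp Require Import all_boot all_order all_algebra all_fingroup.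
From mathcomp Require Import cyclic finfield ring.
Set Implicit Arguments.
Unset Strict Implicit.
Unset Printing Implicit Defensive.
Import GRing.Theory.
Local Open Scope ring_scope.

(** In each of the three algebras, the vanishing of one coordinate of a product
    of nonzero elements makes one factor equal to e times the image of the other
    under an involution, for a nonzero scalar e in L: the involution is bar on F
    and (c, d) |-> (c, - d) on L * L.  Substituting, the other coordinate
    becomes a twisted linear factor, in e alone, times an expression of degree
    sigma + 1 in a single factor.  The twisted factor vanishes only if - l is a
    (sigma - 1)-th power ([twisted_linear_neq0]).

    For the pair algebras, [pair_no_zero_divisors] reduces the claim to the
    anisotropy of a binary form Q(c, d).  For C, Q is
    c ^+ (sigma + 1) - R * d ^+ (sigma + 1); for B, a nontrivial zero of Q gives
    the root - (1 + d / c) of the polynomial assumed to have none.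

    For A, elements fixed by bar lie in L, so that 1 and z are independent over
    them and both traces vanish ([traces_independent]).  The first makes y a
    multiple of bar x by an element of L; once the twisted factor is cancelled,
    the second says that bar mu / mu = (bar x / x) ^+ (sigma + 1).  This is
    excluded because a (sigma + 1)-th power in the group of (p ^ m - 1)-th
    powers lies in every subgroup whose index divides sigma + 1
    ([unit_powers_expg_mem]). *)

(** * Finite fields and power subgroups *)

Lemma exprD_card (K : finFieldType) (p k r : nat) (x y : K) :
  prime p -> #|K| = (p ^ k)%N ->
  (x + y) ^+ (p ^ r) = x ^+ (p ^ r) + y ^+ (p ^ r).
Proof.
move=> p_prime cardK; have pcharK := card_finPcharP cardK p_prime.
by apply: exprDn_pchar; rewrite pnatX pnatE // pcharK.
Qed.

(** The image of L already accounts for all the roots of X ^ #|L| - X. *)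
Lemma fixed_in_subfield (L F : finFieldType) (iota : {rmorphism L -> F}) (x : F) :
  x ^+ #|L| = x -> exists a, x = iota a.
Proof.
move=> xq; have := congr1 (fun P => (map_poly iota P).[x]) (finField_genPoly L).
rewrite rmorphB /= map_polyXn map_polyX !hornerE xq subrr.
rewrite rmorph_prod horner_prod => /esym/eqP; rewrite prodf_seq_eq0.
case/hasP=> a _ /=; rewrite map_polyXsubC hornerXsubC subr_eq0 => /eqP->.
by exists a.
Qed.

(** A nonzero root e would give e ^+ (r - 1) = - l. *)
Lemma twisted_linear_neq0 (L : finFieldType) (r : nat) (l e : L) :
  (0 < r)%N -> - l \notin powers L (r - 1) -> e != 0 -> e ^+ r + l * e != 0.
Proof.
move=> r_gt0 nl e0; apply: contraNneq nl => eq0.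
apply/imsetP; exists e => //; apply: (mulIf e0).
by rewrite -exprSr subn1 prednK // mulNr -[RHS](addrK (l * e)) eq0 sub0r.
Qed.

Lemma expg_index_normal (gT : finGroupType) (G H : {group gT}) (x : gT) :
  (H <| G)%g -> x \in G -> (x ^+ #|G : H|)%g \in H.
Proof.
case/andP=> sHG nHG Gx; have Nx := subsetP nHG x Gx.
apply: coset_idr; first exact: groupX.
by rewrite morphX // -card_quotient // expg_cardG // mem_quotient.
Qed.

Lemma unit_field_mulgC (K : finFieldType) (u v : {unit K}) : (u * v = v * u)%g.
Proof. by apply: val_inj; rewrite /= mulrC. Qed.

Lemma unit_powers_group_set (K : finFieldType) (k : nat) :
  group_set (unit_powers K k).
Proof.
apply/group_setP; split; first by apply/imsetP; exists 1%g; rewrite ?expg1n.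
move=> _ _ /imsetP[u _ ->] /imsetP[v _ ->]; apply/imsetP.
exists (u * v)%g; rewrite // expgMn //; exact: unit_field_mulgC.
Qed.

(** The power subgroup being abelian, its quotient by H is a group of order
    the index. *)
Lemma unit_powers_expg_mem (K : finFieldType) (k r : nat) (H : {group {unit K}})
    (u : {unit K}) :
  H \subset unit_powers K k -> (#|unit_powers K k : H|%g %| r)%N ->
  ((u ^+ k) ^+ r)%g \in H.
Proof.
pose U := Group (unit_powers_group_set K k).
move=> sHU /dvdnP[j ->]; rewrite mulnC expgM groupX //.
apply: (@expg_index_normal _ U); last by apply/imsetP; exists u.
rewrite /normal sHU; apply/subsetP => v _; rewrite inE; apply/subsetP => w.
case/imsetP=> h Hh ->; rewrite conjgE.
by rewrite (_ : (h * v = v * h)%g) ?mulKg //; apply: unit_field_mulgC.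
Qed.

(** * Multiplications on pairs *)

Lemma pair_proportional (K : fieldType) (a b c d : K) :
  (a, b) != 0 -> (c, d) != 0 -> a * d + b * c = 0 ->
  exists2 e, e != 0 & (a, b) = (e * c, - (e * d)).
Proof.
move=> ab0 cd0 det0.
suff [e def_ab]: exists e, (a, b) = (e * c, - (e * d)).
  exists e => //; apply: contraNneq ab0 => e0.
  by rewrite def_ab e0 !mul0r oppr0.
have [c0 | c0] := eqVneq c 0; last first.
  exists (a / c); rewrite divfK //; congr pair; apply: (mulIf c0).
  rewrite -[LHS](addKr (a * d)) det0 addr0 mulNr; congr (- _); field.
  exact: c0.
have d0: d != 0 by apply: contraNneq cd0 => d0; rewrite c0 d0.
exists (- (b / d)); rewrite !mulNr divfK // opprK; congr pair.
move/eqP: det0; rewrite c0 !mulr0 addr0 oppr0 mulf_eq0 (negPf d0).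
by rewrite orbF => /eqP.
Qed.

(** The second coordinate of a product of pairs is the determinant (up to sign)
    of u and (c, - d), where v = (c, d), so its vanishing makes u proportional
    to (c, - d). *)
Lemma pair_no_zero_divisors (L : finFieldType) (r : nat) (l : L)
    (mul : L * L -> L * L -> L * L) (Q : L -> L -> L) :
  (0 < r)%N -> - l \notin powers L (r - 1) ->
  (forall u v, (mul u v).2 = u.1 * v.2 + u.2 * v.1) ->
  (forall e c d, (mul (e * c, - (e * d)) (c, d)).1 = (e + l * e ^+ r) * Q c d) ->
  (forall c d, Q c d = 0 -> (c, d) = 0) ->
  forall u v, mul u v = 0 -> u = 0 \/ v = 0.
Proof.
move=> r_gt0 nl mul2 mul1 Qaniso [a b] [c d] uv0.
have [->|ab0] := eqVneq (a, b) 0; first by left.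
have [->|cd0] := eqVneq (c, d) 0; [by right | exfalso].
have /= det0 := mul2 (a, b) (c, d); rewrite uv0 in det0.
have [e e0 def_ab] := pair_proportional ab0 cd0 (esym det0).
have := mul1 e c d; rewrite -def_ab uv0 => /esym/eqP; rewrite mulf_eq0.
case/orP=> [|/eqP/Qaniso cd]; last by rewrite cd eqxx in cd0.
(* Dividing by e * e ^+ r turns the factor into the twisted one at e^-1. *)
apply/negP; have := twisted_linear_neq0 r_gt0 nl (invr_neq0 e0).
apply: contraNneq => f0; have er0: e ^+ r != 0 by rewrite expf_neq0.
have -> : e^-1 ^+ r + l * e^-1 = (e + l * e ^+ r) / (e * e ^+ r).
  by rewrite exprVn; field; rewrite e0 er0.
by rewrite f0 mul0r.
Qed.

Lemma B_form_anisotropic (L : finFieldType) (p m s : nat) (n N c d : L) :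
  prime p -> #|L| = (p ^ m)%N -> odd p -> n != 0 -> N != 0 ->
  (forall t : L, ~~ root (B_poly p s n N) t) ->
  c ^+ (p ^ s) * c + n * c ^+ (p ^ s) * d + n * N * c * d ^+ (p ^ s)
    + n * N * d ^+ (p ^ s) * d = 0 ->
  (c, d) = 0.
Proof.
move=> p_prime cardL p_odd n0 N0 noroot Q0.
have r_gt0: (0 < p ^ s)%N by rewrite expn_gt0 prime_gt0.
have [c0|c0] := eqVneq c 0.
  rewrite {}c0 expr0n eqn0Ngt r_gt0 /= in Q0 *; congr pair.
  apply/eqP; move/eqP: Q0; rewrite !(mul0r, mulr0, add0r) -mulrA -exprSr.
  by rewrite !mulf_eq0 (negPf n0) (negPf N0) expf_eq0.
have cr0: c ^+ (p ^ s) != 0 by rewrite expf_neq0.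
(* With u = d / c the form is u ^ (r + 1) + u ^ r + u / N + 1 / (n * N), up to
   a factor; shifting u by 1 removes the term u ^ r, and the sign, harmless for
   the even exponent r + 1, gives the linear coefficient the right sign. *)
case/negP: (noroot (- (1 + d / c))).
rewrite /root /B_poly !hornerE addn1 exprSr exprNn -signr_odd oddX.
rewrite p_odd orbT expr1 (exprD_card _ _ _ p_prime cardL) expr1n exprMn exprVn.
rewrite -(mulr0 ((n * N * c ^+ (p ^ s) * c)^-1)) -Q0; apply/eqP.
by field; rewrite c0 cr0 n0 N0.
Qed.

Lemma C_form_anisotropic (L : finFieldType) (r : nat) (R c d : L) :
  R \notin powers L (r + 1) -> c ^+ r * c - R * d ^+ r * d = 0 -> (c, d) = 0.
Proof.
move=> nR /eqP; rewrite subr_eq0 -mulrA -!exprSr => /eqP Q0.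
have [d0|d0] := eqVneq d 0.
  move/eqP: Q0; rewrite d0 [0 ^+ _]expr0n mulr0 expf_eq0 => /eqP->.
  by [].
case/negP: nR; apply/imsetP; exists (c / d) => //.
by rewrite addn1 exprMn exprVn Q0 mulfK // expf_neq0.
Qed.

(** * Multiplication on the quadratic extension *)

Section QuadraticExtension.

Variables (p m : nat) (L F : finFieldType) (iota : {rmorphism L -> F}).
Hypotheses (p_prime : prime p).
Hypotheses (cardL : #|L| = (p ^ m)%N) (cardF : #|F| = (p ^ (2 * m))%N).

Let barD (x y : F) : bar p m (x + y) = bar p m x + bar p m y.
Proof. exact: exprD_card cardF. Qed.

Let barM (x y : F) : bar p m (x * y) = bar p m x * bar p m y.
Proof. exact: exprMn. Qed.

Let barX (x : F) k : bar p m (x ^+ k) = bar p m x ^+ k.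
Proof. exact: exprAC. Qed.

Let barK (x : F) : bar p m (bar p m x) = x.
Proof. by rewrite /bar -exprM -expnD addnn -mul2n -cardF expf_card. Qed.

Let barV (x : F) : bar p m x^-1 = (bar p m x)^-1.
Proof. exact: exprVn. Qed.

Let bar_iota a : bar p m (iota a) = iota a.
Proof. by rewrite /bar -rmorphXn -cardL expf_card. Qed.

Let bar_fixed (x : F) : bar p m x = x -> exists a, x = iota a.
Proof. by rewrite /bar -cardL; apply: fixed_in_subfield. Qed.

Let bar_trace (x : F) : bar p m (trace p m x) = trace p m x.
Proof. by rewrite /trace barD barK addrC. Qed.

(** Traces are fixed by bar, hence lie in L, while z does not. *)
Lemma traces_independent (z x y : F) :
  z \notin codom iota -> trace p m x + trace p m y * z = 0 ->
  trace p m x = 0 /\ trace p m y = 0.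
Proof.
have [a ->] := bar_fixed (bar_trace x); have [b ->] := bar_fixed (bar_trace y).
move=> zL ab0; have [b0 | b0] := eqVneq (iota b) 0.
  by move: ab0; rewrite b0 mul0r addr0.
case/negP: zL; rewrite (_ : z = iota (- a / b)) ?codom_f //.
apply: (mulfI b0); rewrite fmorph_div rmorphN mulrCA mulfV // mulr1.
by rewrite -[LHS](addKr (iota a)) ab0 addr0.
Qed.

(** Trace zero for omega means bar omega = - omega, so that omega * x is skew
    only when x is symmetric. *)
Lemma trace_skew_mul (omega x : F) :
  omega != 0 -> trace p m omega = 0 -> trace p m (omega * x) = 0 ->
  bar p m x = x.
Proof.
move=> omega0 /eqP; rewrite /trace addrC addr_eq0 => /eqP bar_omega.
by rewrite /trace barM bar_omega mulNr => /subr0_eq /(mulfI omega0).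
Qed.

(** If both traces vanish, y = e * bar x with e in L, and the argument of the
    second trace, without the factor omega * mu, is
    (e ^+ sigma + l * e) * bar x ^+ (sigma + 1).  The condition on mu says that
    multiplying it by mu does not give an element fixed by bar. *)
Lemma A_no_zero_divisors (s : nat) (omega z mu : F) (l : L) :
  omega != 0 -> trace p m omega = 0 -> z \notin codom iota ->
  - l \notin powers L (p ^ s - 1) ->
  (forall x, x != 0 ->
     mu * bar p m x ^+ (p ^ s + 1) != bar p m mu * x ^+ (p ^ s + 1)) ->
  forall x y, A_mul p m s omega z (iota l) mu x y = 0 -> x = 0 \/ y = 0.
Proof.
move=> omega0 tr_omega zL nl nmu x y; rewrite /A_mul.
case/(traces_independent zL); rewrite -!mulrA.
move=> /(trace_skew_mul omega0 tr_omega) bar_xy.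
move=> /(trace_skew_mul omega0 tr_omega) bar_u.
have [-> | x0] := eqVneq x 0; first by left.
have [-> | y0] := eqVneq y 0; [by right | exfalso].
have bx0: bar p m x != 0 by rewrite expf_neq0.
(* As x * y and x * bar x lie in L, so does the ratio y / bar x. *)
have [e def_y]: exists e, y = iota e * bar p m x.
  have [e def_e]: exists e, y / bar p m x = iota e.
    apply: bar_fixed.
    have ->: y / bar p m x = x * y / (x * bar p m x) by field; rewrite bx0 x0.
    by rewrite barM bar_xy barV barM barK [bar p m x * x]mulrC.
  by exists e; rewrite -def_e divfK.
have e0: e != 0.
  by apply: contraNneq y0 => e0; rewrite def_y e0 rmorph0 mul0r.
have r_gt0: (0 < p ^ s)%N by rewrite expn_gt0 prime_gt0.
have t0 := twisted_linear_neq0 r_gt0 nl e0.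
have def_u: bar p m x * y ^+ (p ^ s) + iota l * (bar p m x ^+ (p ^ s) * y)
    = iota (e ^+ (p ^ s) + l * e) * bar p m x ^+ (p ^ s + 1).
  by rewrite def_y exprMn addn1 exprSr rmorphD rmorphM rmorphXn; ring.
case/negP: (nmu x x0); rewrite eq_sym.
rewrite -(inj_eq (mulfI (_ : iota (e ^+ (p ^ s) + l * e) != 0))); last first.
  by rewrite fmorph_eq0.
move: bar_u; rewrite def_u !barM barX barK bar_iota.
by rewrite !(mulrCA (iota _)) => ->.
Qed.

End QuadraticExtension.

Theorem theorem1p1 (p m s : nat) (L F : finFieldType) (iota : {rmorphism L -> F})
    (l n N R : L) (mu : {unit F})
    (p_prime : prime p) (m_gt0 : (0 < m)%N) (s_gt0 : (1 <= s)%N) (s_lt_m : (s < m)%N)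
    (cardL : #|L| = (p ^ m)%N) (cardF : #|F| = (p ^ (2 * m))%N)
    (l_neq0 : l != 0) (n_neq0 : n != 0) (N_neq0 : N != 0) (R_neq0 : R != 0) :
  [/\ forall (omega z : F) (H : {group {unit F}}),
        omega != 0 -> trace p m omega = 0 -> (p = 2%N -> omega = 1) ->
        z \notin codom iota ->
        - l \notin powers L (p ^ s - 1) ->
        H \subset unit_powers F (p ^ m - 1) ->
        #|unit_powers F (p ^ m - 1) : H|%g = gcdn (p ^ m + 1) (p ^ s + 1) ->
        (mu ^+ (p ^ m) * mu^-1)%g \notin H ->
        presemifield_of_order (A_mul p m s omega z (iota l) (val mu)) (p ^ (2 * m)),
      odd p ->
      - l \notin powers L (p ^ s - 1) ->
      (forall t : L, ~~ root (B_poly p s n N) t) ->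
      presemifield_of_order (B_mul p s l n N) (p ^ (2 * m)) &
      odd p ->
      - l \notin powers L (p ^ s - 1) ->
      R \notin powers L (p ^ s + 1) ->
      presemifield_of_order (C_mul p s l R) (p ^ (2 * m))].
Proof.
have r_gt0: (0 < p ^ s)%N by rewrite expn_gt0 prime_gt0.
have powLD (x y : L): (x + y) ^+ (p ^ s) = x ^+ (p ^ s) + y ^+ (p ^ s).
  exact: exprD_card cardL.
have powFD r (x y : F): (x + y) ^+ (p ^ r) = x ^+ (p ^ r) + y ^+ (p ^ r).
  exact: exprD_card cardF.
have cardLL: #|{: L * L}| = (p ^ (2 * m))%N.
  by rewrite card_prod cardL -expnD addnn mul2n.
split.
- move=> omega z H omega0 tr_omega _ zL nl sHU indexH nmu; split=> //; split.
  + move=> x y t; rewrite /A_mul /trace /bar.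
    rewrite !(powFD, exprMn, mulrDr, mulrDl); ring.
  + move=> x y t; rewrite /A_mul /trace /bar.
    rewrite !(powFD, exprMn, mulrDr, mulrDl); ring.
  apply: (A_no_zero_divisors p_prime cardL cardF) => // x x0.
  apply: contraNneq nmu => mux; have Ux: x \is a GRing.unit by rewrite unitfE.
  have: (#|unit_powers F (p ^ m - 1) : H|%g %| p ^ s + 1)%N
    by rewrite indexH dvdn_gcdr.
  move/(unit_powers_expg_mem (FinRing.unit F Ux) sHU).
  (* The relation mux says exactly that these two units agree. *)
  rewrite (_ : (_ ^+ _ ^+ _)%g = mu ^+ (p ^ m) * mu^-1)%g //.
  apply: val_inj; rewrite /= !(FinRing.val_unitX, FinRing.val_unitM,
                             FinRing.val_unitV) /=.
  have q_gt0: (0 < p ^ m)%N by rewrite expn_gt0 prime_gt0.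
  have mu0: val mu != 0 by rewrite -unitfE (valP mu).
  have xr0: x ^+ (p ^ s + 1) != 0 by rewrite expf_neq0.
  apply: (mulfI mu0); apply: (mulIf xr0); rewrite mulrCA mulfV // mulr1.
  by rewrite -mux -mulrA -exprMn -exprSr subn1 prednK.
- move=> p_odd nl noroot; split=> //; split.
  + move=> [a b] [c d] [e f]; rewrite /B_mul /=; congr pair;
    rewrite /= ?powLD; ring.
  + move=> [a b] [c d] [e f]; rewrite /B_mul /=; congr pair;
    rewrite /= ?powLD; ring.
  apply: (pair_no_zero_divisors r_gt0 nl) => [[a b] [c d]|e c d|c d] //; last first.
    exact: B_form_anisotropic cardL p_odd n_neq0 N_neq0 noroot.
  rewrite /= exprNn -signr_odd oddX p_odd orbT expr1 !exprMn; ring.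
move=> p_odd nl nR; split=> //; split.
+ move=> [a b] [c d] [e f]; rewrite /C_mul /=; congr pair;
    rewrite /= ?powLD; ring.
+ move=> [a b] [c d] [e f]; rewrite /C_mul /=; congr pair;
    rewrite /= ?powLD; ring.
apply: (pair_no_zero_divisors r_gt0 nl) => [[a b] [c d]|e c d|c d] //; last first.
  exact: C_form_anisotropic nR.
rewrite /= exprNn -signr_odd oddX p_odd orbT expr1 !exprMn; ring.
Qed.
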